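(* Let $m\ge 2$ be an integer. The series $\mathscr{A}_{\overline{\Pi}_{m-1}}$ (the $(m-1)$-headed continued fraction, i.e. the series of shift-plethystic trees enriched with $\overline{\Pi}_{m-1}$) satisfies $$\mathscr{A}_{\overline{\Pi}_{m-1}}=X_0\,(\sigma^{m-1}\mathscr{C}^{(m-1)})^{-1}\,\mathscr{C}^{(m-1)},$$ its commutative image satisfies $$\mathscr{A}_{\overline{\Pi}_{m-1}}(\mathbf{x},z)=zx_0\,\frac{\mathscr{C}^{(m-1)}(\mathbf{x},z)}{(\sigma^{m-1}\mathscr{C}^{(m-1)})(\mathbf{x},z)},$$ and its $q$-series satisfies $$\mathscr{A}_{\overline{\Pi}_{m-1}}(z)=z\,\frac{\mathscr{C}^{(m-1)}(z)}{\mathscr{C}^{(m-1)}(zq^{m-1})}.$$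
   Context: $\mathbb{K}$ is a field of characteristic zero, $\mathbb{X}=\{X_0,X_1,X_2,\dots\}$, and $\mathbb{K}\langle\langle\mathbb{X}\rangle\rangle$ is the algebra of noncommutative formal power series in $\mathbb{X}$. For $\kappa=(k_1,\dots,k_\ell)\in\mathbb{N}^\ell$ ($\mathbb{N}\ni 0$) write $X_\kappa=X_{k_1}\cdots X_{k_\ell}$ (empty word $=1$) and $\langle R,X_\kappa\rangle$ for the coefficient of $X_\kappa$ in $R$. Shift: $\sigma$ is the continuous algebra endomorphism with $\sigma X_i=X_{i+1}$. Shift-plethysm: for $S$ with zero constant term, $R\circ_s S=\sum_{\kappa}\langle R,X_\kappa\rangle(\sigma^{k_1}S)(\sigma^{k_2}S)\cdots(\sigma^{k_\ell}S)$. $\mathscr{C}^{(n)}$ is the sum of the words $X_\kappa$ over all compositions $\kappa=(k_1,\dots,k_\ell)$, $\ell\ge 0$, with all $k_i\ge 1$ and $k_{i+1}-k_i\le n$ for $1\le i<\ell$ (including the empty word and all single letters $X_k$, $k\ge1$). For $n\ge1$, $\overline{\Pi}_n=(1-X_n)^{-1}(1-X_{n-1})^{-1}\cdots(1-X_1)^{-1}$ (partitions in weakly decreasing order with parts at most $n$), and $\mathscr{A}_{\overline{\Pi}_n}$ is the unique series with zero constant term satisfying $\mathscr{A}_{\overline{\Pi}_n}=X_0\,(\overline{\Pi}_n\circ_s\mathscr{A}_{\overline{\Pi}_n})$. Commutative images: for a series $R$, $R(\mathbf{x},z)$ denotes its image under $X_k\mapsto zx_k$ with $z,x_0,x_1,\dots$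 commuting variables, and $R(z)$ denotes its image under $X_k\mapsto zq^k$. *)

(* Defs.v *)
From HB Require Import structures.
From mathcomp Require Import all_boot all_algebra finmap.
From mathcomp Require Import boolp classical_sets functions cardinality fsbigop.
From mathcomp Require Import monalg.

Set Implicit Arguments.
Unset Strict Implicit.
Unset Printing Implicit Defensive.

Import GRing.Theory.

Local Open Scope ring_scope.

(* Monoids over which every function is a formal power series: each element   *)
(* has finitely many factorizations, and a degree that is additive and        *)
(* vanishes only at the identity.                                             *)
HB.mixin Record MonomialDef_isFinFact M of MonomialDef M := {
  ffdeg : M -> nat;
  ffdegM : {morph ffdeg : a b / mmul a b >-> (a + b)%N};
  ffdeg_eq0I : forall m : M, ffdeg m = 0%N -> m = mone;
  finite_factor : forall m : M, finite_set [set p : M * M | mmul p.1 p.2 = m]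
}.

#[short(type="ffMonomType")]
HB.structure Definition FFMonom :=
  { M of MonomialDef M & MonomialDef_isFinFact M }.

#[short(type="ffConomType")]
HB.structure Definition FFConom :=
  { M of ConomialDef M & MonomialDef_isFinFact M }.

Section FmonomFinFact.
Context (I : choiceType).

Let word_finite_factor (w : {fmonom I}) :
  finite_set [set p : {fmonom I} * {fmonom I} | mmul p.1 p.2 = w].
Proof.
pose g (i : 'I_(size w).+1) := (FMonom (take i w), FMonom (drop i w)).
apply: (@sub_finite_set _ _ [set g i | i in [set: 'I_(size w).+1]]); last first.
  exact/finite_image/finite_finset.
move=> [a b] /= abw; have lt_aw : (size a < (size w).+1)%N.
  by rewrite ltnS -abw fmM size_cat leq_addr.
exists (Ordinal lt_aw) => //; rewrite /g /= -abw fmM take_size_cat //.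
by rewrite drop_size_cat // !fmK.
Qed.

HB.instance Definition _ := MonomialDef_isFinFact.Build {fmonom I}
  (@fdegM I) (@fdeg_eq0I I) word_finite_factor.
End FmonomFinFact.

Section CmonomFinFact.
Context (I : choiceType).

Let cmonom_finite_factor (m : {cmonom I}) :
  finite_set [set p : {cmonom I} * {cmonom I} | mmul p.1 p.2 = m].
Proof.
pose T := {ffun finsupp m -> 'I_(mdeg m).+1}.
pose h (u : T) : {cmonom I} := [cmonom nat_of_ord (u i) | i : finsupp m]%M.
apply: (@sub_finite_set _ _ [set (h u.1, h u.2) | u in [set: T * T]]); last first.
  exact/finite_image/finite_finset.
have hP (a : {cmonom I}) : (forall i, a i <= m i)%N -> exists u, h u = a.
  move=> le_am; have lt_a i : (a i < (mdeg m).+1)%N.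
    rewrite ltnS (leq_trans (le_am i)) // mdegE.
    case: (mdomP m i) => // mi; rewrite (big_fsetD1 i) //=; exact: leq_addr.
  exists [ffun i => Ordinal (lt_a (val i))].
  apply/eqP/cmP => i; rewrite /h cmE /=.
  rewrite fsfun_ffun; case: insubP => [j _ ij|] /=; first by rewrite ffunE /= ij.
  by rewrite -cmE_eq0 => /eqP mi; have := le_am i; rewrite mi leqn0 => /eqP.
move=> [a b] /= abm.
have [i|u ua] := hP a; first by rewrite -abm cmM leq_addr.
have [i|v vb] := hP b; first by rewrite -abm cmM leq_addl.
by exists (u, v) => //=; rewrite ua vb.
Qed.

HB.instance Definition _ := MonomialDef_isFinFact.Build {cmonom I}
  (@mdegM I) (@mdeg_eq0I I) cmonom_finite_factor.
End CmonomFinFact.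

Definition fps (K : fieldType) (M : ffMonomType) : Type := M -> K.

Section FpsRing.
Context (K : fieldType) (M : ffMonomType).
Implicit Types (f g h : fps K M) (m : M) (a : K).

HB.instance Definition _ := gen_eqMixin (fps K M).
HB.instance Definition _ := gen_choiceMixin (fps K M).

Lemma fpsP f g : (forall m, f m = g m) -> f = g.
Proof. exact: funext. Qed.

Definition fps_zero : fps K M := fun=> 0.
Definition fps_opp f : fps K M := fun m => - f m.
Definition fps_add f g : fps K M := fun m => f m + g m.
Definition fps_scale a f : fps K M := fun m => a * f m.
Definition mono m : fps K M := fun n => (n == m)%:R.
Definition fps_mul f g : fps K M :=
  fun m => \sum_(p \in [set p : M * M | mmul p.1 p.2 = m]) f p.1 * g p.2.

Let fps_addA : associative fps_add.
Proof. by move=> f g h; apply/fpsP => m; exact: addrA. Qed.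
Let fps_addC : commutative fps_add.
Proof. by move=> f g; apply/fpsP => m; exact: addrC. Qed.
Let fps_add0 : left_id fps_zero fps_add.
Proof. by move=> f; apply/fpsP => m; exact: add0r. Qed.
Let fps_addN : left_inverse fps_zero fps_opp fps_add.
Proof. by move=> f; apply/fpsP => m; exact: addNr. Qed.

HB.instance Definition _ := GRing.isZmodule.Build (fps K M)
  fps_addA fps_addC fps_add0 fps_addN.

Lemma fps0E m : (0 : fps K M) m = 0. Proof. by []. Qed.
Lemma fpsNE f m : (- f) m = - f m. Proof. by []. Qed.
Lemma fpsDE f g m : (f + g) m = f m + g m. Proof. by []. Qed.
Lemma fpsBE f g m : (f - g) m = f m - g m. Proof. by []. Qed.
Lemma fps_sumE (T : Type) (r : seq T) (P : pred T) (F : T -> fps K M) m :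
  (\sum_(i <- r | P i) F i) m = \sum_(i <- r | P i) F i m.
Proof. by elim/big_rec2: _ => //= i x y _ <-. Qed.

Definition factors m : seq (M * M) :=
  fset_set [set p : M * M | mmul p.1 p.2 = m].

Lemma factorsP m p : (p \in factors m) = (mmul p.1 p.2 == m).
Proof.
rewrite in_fset_set; last exact: finite_factor.
by apply/idP/eqP; rewrite inE.
Qed.

Lemma factors_uniq m : uniq (factors m). Proof. exact: fset_uniq. Qed.

Lemma fps_mul_factors f g m :
  fps_mul f g m = \sum_(p <- factors m) f p.1 * g p.2.
Proof. by rewrite /fps_mul fsbig_finite //; exact: finite_factor. Qed.

Let fps_mulA : associative fps_mul.
Proof.
move=> f g h; apply/fpsP => m; rewrite !fps_mul_factors.
pose F (t : M * M * M) := f t.1.1 * g t.1.2 * h t.2.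
transitivity (\sum_(t <- [seq (p.1, q.1, q.2) | p <- factors m,
                                               q <- factors p.2]) F t).
  rewrite big_allpairs_dep; apply: eq_bigr => p _.
  rewrite fps_mul_factors mulr_sumr; apply: eq_bigr => q _; exact: mulrA.
transitivity (\sum_(t <- [seq (q.1, q.2, p.2) | p <- factors m,
                                               q <- factors p.1]) F t); last first.
  rewrite big_allpairs_dep; apply: eq_bigr => p _.
  by rewrite fps_mul_factors mulr_suml; apply: eq_bigr => q _.
apply/perm_big/uniq_perm.
- apply: allpairs_uniq_dep => [|p _|]; rewrite ?factors_uniq //.
  move=> _ _ /allpairsPdep[p [q [_ qp ->]]] /allpairsPdep[p' [q' [_ qp' ->]]] /=.
  rewrite !factorsP in qp qp'; case: p p' q q' qp qp' => [? ?] [? ?] [? ?] [? ?].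
  by move=> /= /eqP <- /eqP <- [-> -> ->].
- apply: allpairs_uniq_dep => [|p _|]; rewrite ?factors_uniq //.
  move=> _ _ /allpairsPdep[p [q [_ qp ->]]] /allpairsPdep[p' [q' [_ qp' ->]]] /=.
  rewrite !factorsP in qp qp'; case: p p' q q' qp qp' => [? ?] [? ?] [? ?] [? ?].
  by move=> /= /eqP <- /eqP <- [-> -> ->].
- move=> [[x y] z]; apply/allpairsPdep/allpairsPdep => -[[a b] [[c d]]].
    rewrite !factorsP /= => -[/eqP <- /eqP <- [-> -> ->]].
    by exists (mmul a c, d), (a, c); rewrite !factorsP /= mulmA !eqxx.
  rewrite !factorsP /= => -[/eqP <- /eqP <- [-> -> ->]].
  by exists (c, mmul d b), (d, b); rewrite !factorsP /= mulmA !eqxx.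
Qed.

Let fps_mul1 : left_id (mono mone) fps_mul.
Proof.
move=> f; apply/fpsP => m; rewrite fps_mul_factors.
rewrite (bigD1_seq (mone, m)) ?factors_uniq ?factorsP ?mul1m //=.
rewrite /mono eqxx mul1r big_seq_cond big1 ?addr0 // => -[a b].
rewrite factorsP /= => /andP[/eqP <-]; case: (eqVneq a mone) => [->|_ _].
  by rewrite mul1m eqxx.
by rewrite mul0r.
Qed.

Let fps_mulr1 : right_id (mono mone) fps_mul.
Proof.
move=> f; apply/fpsP => m; rewrite fps_mul_factors.
rewrite (bigD1_seq (m, mone)) ?factors_uniq ?factorsP ?mulm1 //=.
rewrite /mono eqxx mulr1 big_seq_cond big1 ?addr0 // => -[a b].
rewrite factorsP /= => /andP[/eqP <-]; case: (eqVneq b mone) => [->|_ _].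
  by rewrite mulm1 eqxx.
by rewrite mulr0.
Qed.

Let fps_mulDl : left_distributive fps_mul +%R.
Proof.
move=> f g h; apply/fpsP => m; rewrite fpsDE !fps_mul_factors -big_split /=.
by apply: eq_bigr => p _; rewrite -mulrDl.
Qed.

Let fps_mulDr : right_distributive fps_mul +%R.
Proof.
move=> f g h; apply/fpsP => m; rewrite fpsDE !fps_mul_factors -big_split /=.
by apply: eq_bigr => p _; rewrite -mulrDr.
Qed.

Let fps_oner_neq0 : mono mone != 0.
Proof.
apply/eqP => /(congr1 (fun f : fps K M => f mone)) /eqP.
by rewrite /mono eqxx fps0E oner_eq0.
Qed.

HB.instance Definition _ := GRing.Zmodule_isNzRing.Build (fps K M)
  fps_mulA fps_mul1 fps_mulr1 fps_mulDl fps_mulDr fps_oner_neq0.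

Lemma fps1E m : (1 : fps K M) m = (m == mone)%:R. Proof. by []. Qed.

Lemma fpsME f g m : (f * g) m = \sum_(p <- factors m) f p.1 * g p.2.
Proof. exact: fps_mul_factors. Qed.

Let fps_scaleA a b f : fps_scale a (fps_scale b f) = fps_scale (a * b) f.
Proof. by apply/fpsP => m; exact: mulrA. Qed.
Let fps_scale1 : left_id 1 fps_scale.
Proof. by move=> f; apply/fpsP => m; exact: mul1r. Qed.
Let fps_scaleDr : right_distributive fps_scale +%R.
Proof. by move=> a f g; apply/fpsP => m; exact: mulrDr. Qed.
Let fps_scaleDl f : {morph fps_scale^~ f : a b / a + b}.
Proof. by move=> a b; apply/fpsP => m; exact: mulrDl. Qed.

HB.instance Definition _ := GRing.Zmodule_isLmodule.Build K (fps K M)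
  fps_scaleA fps_scale1 fps_scaleDr fps_scaleDl.

Lemma fpsZE a f m : (a *: f) m = a * f m. Proof. by []. Qed.

Let fps_scaleAl a f g : a *: (f * g) = (a *: f) * g.
Proof.
apply/fpsP => m; rewrite fpsZE !fpsME mulr_sumr.
by apply: eq_bigr => p _; rewrite mulrA.
Qed.
HB.instance Definition _ := GRing.Lmodule_isLalgebra.Build K (fps K M) fps_scaleAl.

Let fps_scaleAr a f g : a *: (f * g) = f * (a *: g).
Proof.
apply/fpsP => m; rewrite fpsZE !fpsME mulr_sumr.
by apply: eq_bigr => p _; rewrite mulrCA.
Qed.
HB.instance Definition _ := GRing.Lalgebra_isAlgebra.Build K (fps K M) fps_scaleAr.

(* The coefficient of m is a sum over the i with F i m != 0, hence 0 when     *)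
(* there are infinitely many of them.                                         *)
Definition fpsum (I : choiceType) (F : I -> fps K M) : fps K M :=
  fun m => \sum_(i \in [set: I]) F i m.

Lemma factors_deg m p : p \in factors m -> ffdeg m = (ffdeg p.1 + ffdeg p.2)%N.
Proof. by rewrite factorsP => /eqP <-; rewrite ffdegM. Qed.

Lemma ffdeg1 : ffdeg (mone : M) = 0%N.
Proof.
have := ffdegM (mone : M) mone; rewrite mulm1 => /eqP.
by rewrite -[X in X == _]addn0 eqn_add2l eq_sym => /eqP.
Qed.

Lemma factors1 : factors mone = [:: (mone, mone)].
Proof.
apply/perm_small_eq => //; apply: uniq_perm; rewrite ?factors_uniq // => -[a b].
rewrite factorsP inE xpair_eqE /=; apply/eqP/andP => [/unitm[-> ->] //|].
by case=> /eqP -> /eqP ->; rewrite mulm1.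
Qed.

Lemma fpsM1 f g : (f * g) mone = f mone * g mone.
Proof. by rewrite fpsME factors1 big_seq1. Qed.

Lemma fpsX_eq0 f n m : f mone = 0 -> (ffdeg m < n)%N -> (f ^+ n) m = 0.
Proof.
move=> f1; elim: n m => // n IHn m; rewrite ltnS exprS fpsME => le_mn.
rewrite big_seq big1 // => -[a b] /factors_deg /= dm.
case: (posnP (ffdeg a)) => [/ffdeg_eq0I->|a_gt0]; first by rewrite f1 mul0r.
by rewrite IHn ?mulr0 // (leq_trans _ le_mn) // dm -addn1 addnC leq_add2r.
Qed.

Definition fps_unit : pred (fps K M) := fun f => f mone != 0.
Definition fps_inv f : fps K M :=
  let c := (f mone)^-1 in
  if f mone != 0 then c *: fpsum (fun n : nat => (1 - c *: f) ^+ n) else f.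

Lemma fpsum_geomE g m N : g mone = 0 -> (ffdeg m < N)%N ->
  fpsum (fun n : nat => g ^+ n) m = (\sum_(n < N) g ^+ n) m.
Proof.
move=> g1 lt_mN; rewrite /fpsum (@fsbigTE _ _ _ _ [fset n in iota 0 N]%fset).
  rewrite fps_sumE -(big_mkord xpredT (fun n => (g ^+ n) m)).
  rewrite /index_iota subn0; apply: perm_big.
  by apply: uniq_perm; rewrite ?fset_uniq ?iota_uniq // => n; rewrite inE.
move=> n; rewrite inE mem_iota /= add0n -leqNgt => le_Nn.
by rewrite fpsX_eq0 // (leq_trans lt_mN).
Qed.

Lemma geom_inv g : g mone = 0 ->
  let s := fpsum (fun n : nat => g ^+ n) in (1 - g) * s = 1 /\ s * (1 - g) = 1.
Proof.
move=> g1 s.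
have sE m k : (ffdeg k <= ffdeg m)%N -> s k = (\sum_(n < (ffdeg m).+1) g ^+ n) k.
  by move=> km; rewrite /s (fpsum_geomE (N := (ffdeg m).+1)) // ltnS.
have tele N : (1 - g) * (\sum_(n < N) g ^+ n) = 1 - g ^+ N.
  by rewrite -[RHS]opprB subrX1 -mulNr opprB.
have telr N : (\sum_(n < N) g ^+ n) * (1 - g) = 1 - g ^+ N.
  rewrite -tele; apply/commr_sym/commr_sum => i _.
  by apply/commr_sym/commrB; [exact: commr1|exact/commr_sym/commrX].
by split; apply/fpsP => m;
  [transitivity (((1 - g) * \sum_(n < (ffdeg m).+1) g ^+ n) m)
  |transitivity (((\sum_(n < (ffdeg m).+1) g ^+ n) * (1 - g)) m)];
  try (by rewrite ?tele ?telr fpsBE fpsX_eq0 ?subr0);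
  rewrite !fpsME; apply: eq_big_seq => p /factors_deg dm;
  rewrite (sE m) // dm ?leq_addr ?leq_addl.
Qed.

Let fps_invP f : f mone != 0 -> fps_inv f * f = 1 /\ f * fps_inv f = 1.
Proof.
move=> f1; rewrite /fps_inv f1; set c := _^-1; set g := 1 - _.
have [] := @geom_inv g.
  by rewrite /g fpsBE fps1E eqxx fpsZE /c mulVf // subrr.
rewrite /g subKr => h1 h2; split.
  by rewrite -scalerAl scalerAr.
by rewrite -scalerAr scalerAl.
Qed.

Let fps_mulVr : {in fps_unit, left_inverse 1 fps_inv *%R}.
Proof. by move=> f /fps_invP[]. Qed.
Let fps_mulrV : {in fps_unit, right_inverse 1 fps_inv *%R}.
Proof. by move=> f /fps_invP[]. Qed.
Let fps_unitP f g : g * f = 1 /\ f * g = 1 -> fps_unit f.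
Proof.
case=> _ /(congr1 (fun h : fps K M => h mone)).
rewrite fpsM1 fps1E eqxx => fg1; apply/eqP => f1.
by move/eqP: fg1; rewrite f1 mul0r eq_sym oner_eq0.
Qed.
Let fps_inv_out : {in [predC fps_unit], fps_inv =1 id}.
Proof. by move=> f; rewrite inE /= /fps_inv unfold_in /fps_unit => /negbTE ->. Qed.

HB.instance Definition _ := GRing.NzRing_hasMulInverse.Build (fps K M)
  fps_mulVr fps_mulrV fps_unitP fps_inv_out.

Lemma fps_unitE f : (f \is a GRing.unit) = (f mone != 0).
Proof. by []. Qed.
End FpsRing.

Section FpsComRing.
Context (K : fieldType) (M : ffConomType).

Let fps_mulC : commutative (@GRing.mul (fps K M)).
Proof.
move=> f g; apply/fpsP => m; rewrite !fpsME.
have swapK : involutive (fun p : M * M => (p.2, p.1)) by case.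
rewrite (perm_big [seq (p.2, p.1) | p <- factors m]) /=.
  by rewrite big_map; apply: eq_bigr => p _; rewrite mulrC.
apply: uniq_perm; rewrite ?(map_inj_uniq (inv_inj swapK)) ?factors_uniq //.
move=> -[a b]; rewrite -[(a, b) in RHS]swapK (mem_map (inv_inj swapK)).
by rewrite !factorsP /= mulmC.
Qed.

HB.instance Definition _ :=
  GRing.PzRing_hasCommutativeMul.Build (fps K M) fps_mulC.
End FpsComRing.

Notation ncfps K := (fps K {fmonom nat}).

Section Substitution.
Context (K : fieldType) (M : ffMonomType).
Implicit Types (f : nat -> fps K M) (R : ncfps K).

(* The image of R under the continuous algebra morphism X_k |-> f k.          *)
Definition fsubst f R : fps K M :=
  fpsum (fun w : {fmonom nat} => R w *: \prod_(k <- w) f k).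

Lemma fsubst1 f R : (forall k, f k mone = 0) -> fsubst f R mone = R mone.
Proof.
move=> f1; rewrite /fsubst /fpsum.
rewrite (@fsbigTE _ _ _ _ [fset (mone : {fmonom nat})]%fset) => [|w].
  by rewrite big_seq_fset1 fpsZE fm1 big_nil fps1E eqxx mulr1.
rewrite inE fpsZE -fdeg_eq0 fdegE; case: w => -[|k w] //= _.
by rewrite big_cons fpsM1 f1 mul0r mulr0.
Qed.
End Substitution.

Section ShiftPlethysm.
Context (K : fieldType).
Implicit Types R S : ncfps K.

Definition X_ (k : nat) : ncfps K := mono K (fmu k).

Definition shift R : ncfps K := fsubst (fun k => X_ k.+1) R.

(* Locally finite when S has zero constant term: iter k shift S then has only *)
(* nonempty words, all of whose letters are at least k.                       *)
Definition shift_plethysm R S : ncfps K := fsubst (fun k => iter k shift S) R.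
End ShiftPlethysm.

Notation "R \os S" := (shift_plethysm R S)
  (at level 50, left associativity) : ring_scope.

Section Series.
Context (K : fieldType).

(* nat subtraction being truncated, k_{i+1} - k_i <= n is written without it. *)
Definition C_series (n : nat) : ncfps K := fun w =>
  (all (leq 1) w && sorted (fun k l => l <= k + n)%N w)%:R.

Definition Pi_series (n : nat) : ncfps K :=
  \prod_(i < n) (1 - X_ K (n - i))^-1.

Definition is_tree_series (R A : ncfps K) : Prop :=
  A mone = 0 /\ A = X_ K 0 * (R \os A).

Definition tree_series (R : ncfps K) : ncfps K :=
  xget 0 [set A | is_tree_series R A]%classic.
End Series.

Section TreeSeriesExistence.
Context (K : fieldType).
Implicit Types (R S A : ncfps K) (N : nat).

Let agree N S S' := forall w : {fmonom nat}, (ffdeg w <= N)%N -> S w = S' w.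

Let ffdegU k : ffdeg (fmu k : {fmonom nat}) = 1%N.
Proof. exact: fdegU. Qed.

Let agreeM N S S' T T' : agree N S S' -> agree N T T' -> agree N (S * T) (S' * T').
Proof.
move=> SS TT w le_wN; rewrite !fpsME; apply: eq_big_seq => p /factors_deg dw.
rewrite SS ?TT // (leq_trans _ le_wN) // dw; [exact: leq_addl|exact: leq_addr].
Qed.

Let agree_subst N (f f' : nat -> ncfps K) R :
  (forall k, agree N (f k) (f' k)) -> agree N (fsubst f R) (fsubst f' R).
Proof.
move=> ff w le_wN; apply: eq_fsbigr => v _; rewrite !fpsZE; congr (_ * _).
elim: (fmonom_val v) w le_wN => [|k r IHr] w le_wN; first by rewrite !big_nil.
rewrite !big_cons; exact: (agreeM (ff k) IHr).
Qed.

Let X_prod_low (f : nat -> nat) (r : seq nat) (w : {fmonom nat}) :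
  (ffdeg w < size r)%N -> (\prod_(k <- r) X_ K (f k)) w = 0.
Proof.
elim: r w => // k r IHr w; rewrite ltnS big_cons fpsME => le_wr.
rewrite big_seq big1 // => p /factors_deg dw; rewrite /X_ {1}/mono.
case: (eqVneq p.1 (fmu (f k))) => [p1|]; last by rewrite mul0r.
by rewrite IHr ?mulr0 // (leq_trans _ le_wr) // dw p1 ffdegU.
Qed.

Let agree_shift N S S' : agree N S S' -> agree N (shift S) (shift S').
Proof.
move=> SS w le_wN; apply: eq_fsbigr => v _; rewrite !fpsZE.
have [le_vN|lt_Nv] := leqP (ffdeg v) N; first by rewrite SS.
by rewrite X_prod_low ?mulr0 // (leq_ltn_trans le_wN).
Qed.

Let agree_os N R S S' : agree N S S' -> agree N (R \os S) (R \os S').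
Proof. by move=> SS; apply: agree_subst; elim=> //= k; exact: agree_shift. Qed.

Let X0M S (w : {fmonom nat}) : w = mone -> (X_ K 0 * S) w = 0.
Proof.
move=> ->; rewrite fpsM1 /X_ /mono eq_sym fm1_eq1; exact: mul0r.
Qed.

Let agree_step N S S' : agree N S S' -> agree N.+1 (X_ K 0 * S) (X_ K 0 * S').
Proof.
move=> SS w le_wN; rewrite !fpsME; apply: eq_big_seq => p /factors_deg dw.
rewrite /X_ /mono; case: (eqVneq p.1 (fmu 0)) => [p1|]; last by rewrite !mul0r.
by rewrite SS // -ltnS (leq_trans _ le_wN) // dw p1 ffdegU.
Qed.

Lemma is_tree_series_uniq R A A' :
  is_tree_series R A -> is_tree_series R A' -> A = A'.
Proof.
move=> [A1 AE] [A'1 A'E]; suff AA N : agree N A A'.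
  by apply/fpsP => w; exact: (AA (ffdeg w)).
elim: N => [w|N IHN].
  by rewrite leqn0 => /eqP/ffdeg_eq0I ->; rewrite A1.
by rewrite AE A'E; apply/agree_step/agree_os.
Qed.

Lemma is_tree_series_ex R : exists A, is_tree_series R A.
Proof.
pose T A := X_ K 0 * (R \os A); pose it N := iter N T 0.
have itS N : agree N (it N) (it N.+1).
  elim: N => [w|N IHN]; last exact/agree_step/agree_os/IHN.
  by rewrite leqn0 => /eqP/ffdeg_eq0I ->; rewrite /it /= /T X0M.
have itD N n : agree N (it N) (it (N + n)%N).
  elim: n => [|n IHn] w le_wN; first by rewrite addn0.
  by rewrite IHn // addnS itS // (leq_trans le_wN) // leq_addr.
pose A : ncfps K := fun w => it (ffdeg w) w.
have Ait N : agree N A (it N).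
  by move=> w le_wN; rewrite /A -[in RHS](subnKC le_wN); apply: itD.
exists A; split; first by rewrite /A ffdeg1.
apply/fpsP => w; rewrite (Ait (ffdeg w).+1) //.
exact/esym/(agree_step (agree_os R (Ait (ffdeg w))) (leqnSn _)).
Qed.

Lemma tree_seriesP R : is_tree_series R (tree_series R).
Proof.
by have [A RA] := is_tree_series_ex R; exact: (@xgetPex _ 0 _ (ex_intro _ A RA)).
Qed.
End TreeSeriesExistence.

Section CommutativeImages.
Context (K : fieldType).

(* Variables of K[[z, x_0, x_1, ...]]: None is z and Some k is x_k.           *)
Definition xz_z : fps K {cmonom option nat} := mono K (ucm None).
Definition xz_x (k : nat) : fps K {cmonom option nat} := mono K (ucm (Some k)).

Definition comm_image (R : ncfps K) : fps K {cmonom option nat} :=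
  fsubst (fun k => xz_z * xz_x k) R.

(* Variables of K[[z, q]]: false is z and true is q.                          *)
Definition zq_z : fps K {cmonom bool} := mono K (ucm false).
Definition zq_q : fps K {cmonom bool} := mono K (ucm true).

(* q_series R u is R(u), the image of R under X_k |-> u q^k; in particular    *)
(* R(z q^j) is q_series R (zq_z * zq_q ^+ j).                                 *)
Definition q_series (R : ncfps K) (u : fps K {cmonom bool}) :
    fps K {cmonom bool} :=
  fsubst (fun k => u * zq_q ^+ k) R.
End CommutativeImages.

Section Units.
Context (K : fieldType) (n : nat).

Lemma X_1 k : X_ K k mone = 0.
Proof. by rewrite /X_ /mono eq_sym fm1_eq1. Qed.

Lemma one_subX_unit k : 1 - X_ K k \is a GRing.unit.
Proof. by rewrite fps_unitE fpsBE X_1 fps1E eqxx subr0 oner_eq0. Qed.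

Lemma C_series1 : C_series K n mone = 1.
Proof. by rewrite /C_series fm1. Qed.

Lemma iter_shift_C1 j : iter j (@shift K) (C_series K n) mone = 1.
Proof.
elim: j => [|j IHj]; first exact: C_series1.
by rewrite iterS -[RHS]IHj; apply: fsubst1 => k; exact: X_1.
Qed.

Lemma iter_shift_C_unit j :
  iter j (@shift K) (C_series K n) \is a GRing.unit.
Proof. by rewrite fps_unitE iter_shift_C1 oner_eq0. Qed.

Lemma comm_image_C_unit j :
  comm_image (iter j (@shift K) (C_series K n)) \is a GRing.unit.
Proof.
rewrite fps_unitE /comm_image fsubst1 ?iter_shift_C1 ?oner_eq0 // => k.
by rewrite fpsM1 /xz_z /mono eq_sym cm1_eq1 mul0r.
Qed.

Lemma q_series_C_unit j :
  q_series (C_series K n) (zq_z K * zq_q K ^+ j) \is a GRing.unit.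
Proof.
rewrite fps_unitE /q_series fsubst1 ?C_series1 ?oner_eq0 // => k.
by rewrite !fpsM1 /zq_z /mono eq_sym cm1_eq1 !mul0r.
Qed.
End Units.

(* Main.v *)
(* Write n = m - 1, C = C_series n, s = shift, and let V be the sum of the     *)
(* words of s C that are empty or start with a letter at most n + 1. Cutting a *)
(* word of C at its last 1 gives C = s C + C X_1 V, and cutting a word of s C  *)
(* before its first letter <= n + 1 gives s C = (s^(n+1) C) V. Hence           *)
(* A = X_0 (s^n C)^-1 C satisfies C (1 - s A) = s C, and the product           *)
(* (1 - s^n A)^-1 ... (1 - s A)^-1 telescopes to (s^n C)^-1 C. The commutative *)
(* images follow because substitution is a ring morphism.                      *)
Require Import Defs.
From HB Require Import structures.
From mathcomp Require Import all_boot all_algebra finmap.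
From mathcomp Require Import boolp classical_sets functions cardinality fsbigop.
From mathcomp Require Import monalg.

Import GRing.Theory.

Local Open Scope classical_set_scope.
Local Open Scope ring_scope.

(** The closed form A = X_0 (s^n C)^-1 C is shown to solve the tree equation, whose solution is
    unique ([is_tree_series_uniq]). The factorizations [C_factor] and [shift_C_factor] share the
    factor V; eliminating it gives C - s C = C X_1 (s^(n+1) C)^-1 (s C) = C (s A), that is, 1 - s A
    = C^-1 (s C). Shifting this identity ([one_sub_shift_tree]) turns each factor of the plethysm of
    [Pi_series] with A into a quotient of two consecutive shifts of C, and the product telescopes
    ([Pi_os_tree]). The shift, the plethysm with A and both commutative images are instances of
    [fsubst], so all rests on its being a ring morphism ([fsubstM]). Since a sum with infinite
    support is 0 by convention, this is proved for locally finite substitutions: no f k has a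
    constant term, and each monomial occurs in finitely many f k. *)

Lemma finite_set_subsingleton (T : Type) (A : set T) :
  (forall x y, A x -> A y -> x = y) -> finite_set A.
Proof.
move=> A1; have [->|/set0P[a Aa]] := eqVneq A set0; first exact: finite_set0.
by apply: (sub_finite_set _ (finite_set1 a)) => x /A1; apply.
Qed.

Lemma fsbigT_seq (R : Type) (idx : R) (op : Monoid.com_law idx) (T : choiceType)
    (r : seq T) (F : T -> R) :
  uniq r -> (forall i, i \notin r -> F i = idx) ->
  \big[op/idx]_(i \in [set: T]) F i = \big[op/idx]_(i <- r) F i.
Proof.
move=> r_uniq Fr; rewrite (@fsbigE _ _ _ _ _ r) // => [|i _]; last exact: Fr.
by apply: eq_bigl => i; rewrite in_setT.
Qed.

Lemma monoM (K : fieldType) (M : ffMonomType) (a b : M) :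
  mono K a * mono K b = mono K (mmul a b).
Proof.
apply/fpsP => m; rewrite fpsME /mono.
have [->|neq_m] := eqVneq m (mmul a b).
  rewrite (bigD1_seq (a, b)) ?factors_uniq ?factorsP //= !eqxx mulr1.
  rewrite big1 ?addr0 // => -[c d]; rewrite xpair_eqE negb_and /=.
  by case/orP=> /negbTE ->; rewrite ?mul0r ?mulr0.
rewrite big_seq big1 // => -[c d]; rewrite factorsP /= => /eqP mE.
have [cE|] := eqVneq c a; last by rewrite mul0r.
have [dE|] := eqVneq d b; last by rewrite mulr0.
by rewrite -mE cE dE eqxx in neq_m.
Qed.

(** * Substitution as a ring morphism *)

Section SubstitutionMorphism.
Context (K : fieldType) (M : ffMonomType) (f : nat -> fps K M).
Implicit Types (R S : ncfps K) (u v w : {fmonom nat}) (m : M).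

Let P w : fps K M := \prod_(k <- w) f k.

Let PM u v : P (mmul u v) = P u * P v.
Proof. by rewrite /P fmM big_cat. Qed.

Let fsubstE R m (r : seq {fmonom nat}) : uniq r ->
  (forall w, P w m != 0 -> w \in r) ->
  fsubst f R m = \sum_(w <- r) R w * P w m.
Proof.
move=> r_uniq suppr; rewrite /fsubst /fpsum.
rewrite (@fsbigT_seq _ _ _ _ r) // => w.
by apply: contraNeq; rewrite fpsZE mulf_eq0 negb_or => /andP[_ /suppr].
Qed.

Hypothesis f1 : forall k, f k mone = 0.
Hypothesis f_fin : forall m, finite_set [set k | f k m != 0].

(** Every letter contributes a factor without constant term, hence degree at least one. *)
Let P_size w m : P w m != 0 -> (size w <= ffdeg m)%N.
Proof.
rewrite /P; elim: (fmonom_val w) m => // k r IHr m.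
rewrite big_cons fpsME; apply: contraNT; rewrite -ltnNge ltnS => lt_mr.
rewrite big_seq big1 // => p /factors_deg dm.
have [/ffdeg_eq0I ->|p_gt0] := posnP (ffdeg p.1); first by rewrite f1 mul0r.
apply/eqP; rewrite mulf_eq0; apply/orP; right; apply: contraTT lt_mr => /IHr.
by rewrite -ltnNge dm => /leq_ltn_trans -> //; rewrite -[ltnLHS]add0n ltn_add2r.
Qed.

(** The length of w is bounded by [P_size]. For a fixed length, induction removes the first letter:
    a nonzero coefficient of a product comes from one of the finitely many factorizations of m. *)
Let P_fin m : finite_set [set w | P w m != 0].
Proof.
suff r_fin n : forall m, finite_set [set r : seq nat | size r = n /\
    (\prod_(k <- r) f k) m != 0].
  apply: (@sub_finite_set _ _ (\bigcup_(n in `I_(ffdeg m).+1)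
    (@FMonom _ @` [set r : seq nat | size r = n /\ (\prod_(k <- r) f k) m != 0]))).
    move=> w /= Pw; exists (size w); first by rewrite /= ltnS P_size.
    by exists (w : seq nat) => //; rewrite fmK.
  by apply: bigcup_finite => // n _; exact/finite_image.
elim: n => [|n IHn] {}m.
  by apply: finite_set_subsingleton => r s [/size0nil -> _] [/size0nil -> _].
apply: (@sub_finite_set _ _ (\bigcup_(p in [set` factors m])
   [set k :: r | k in [set k | f k p.1 != 0] &
      r in [set r : seq nat | size r = n /\ (\prod_(k <- r) f k) p.2 != 0]])).
  case=> [|k r] [] //= [sr]; rewrite big_cons fpsME => kr_neq0.
  have /hasP[p mp p_neq0] : has (fun p => f k p.1 * (\prod_(k <- r) f k) p.2 != 0)
      (factors m).
    apply: contraNT kr_neq0 => /hasPn F0; apply/eqP; rewrite big_seq big1 // => p.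
    by move/F0; rewrite negbK => /eqP.
  move: p_neq0; rewrite mulf_eq0 negb_or => /andP[kp rp].
  by exists p => //; exists k => //; exists r.
by apply: bigcup_finite => // p _; exact: finite_image2.
Qed.

(** One finite list that serves every factorization of m at once, so that sums over words and over
    factorizations can be exchanged in [fsubstM]. *)
Let supp m : seq {fmonom nat} :=
  fset_set (\bigcup_(p in [set` factors m]) [set w | P w p.1 != 0 \/ P w p.2 != 0]).

Let suppP m p w : p \in factors m -> P w p.1 != 0 \/ P w p.2 != 0 -> w \in supp m.
Proof.
move=> mp Pw; rewrite in_fset_set; first by rewrite inE; exists p.
apply: bigcup_finite => // q _.
rewrite (_ : [set _ | _] = [set w | P w q.1 != 0] `|` [set w | P w q.2 != 0])%classic //.
by rewrite finite_setU; split; exact: P_fin.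
Qed.

Lemma fsubstB : {morph fsubst f : R S / R - S}.
Proof.
move=> R S; apply/fpsP => m; rewrite fpsBE.
have sr w : P w m != 0 -> w \in (fset_set [set w | P w m != 0] : seq _).
  by rewrite in_fset_set ?inE.
rewrite !(fsubstE _ _ _ (fset_uniq _) sr) -sumrB; apply: eq_bigr => w _.
by rewrite fpsBE mulrBl.
Qed.

Lemma fsubst_one : fsubst f 1 = 1.
Proof.
apply/fpsP => m; rewrite /fsubst /fpsum (@fsbigT_seq _ _ _ _ [:: mone]) //.
  by rewrite big_seq1 fpsZE fps1E eqxx mul1r fm1 big_nil.
by move=> w; rewrite inE fpsZE fps1E => /negbTE ->; rewrite mul0r.
Qed.

Lemma fsubstX k : fsubst f (X_ K k) = f k.
Proof.
apply/fpsP => m; rewrite /fsubst /fpsum (@fsbigT_seq _ _ _ _ [:: fmu k]) //.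
  by rewrite big_seq1 fpsZE /X_ /mono eqxx mul1r fmU big_seq1.
by move=> w; rewrite inE fpsZE /X_ /mono => /negbTE ->; rewrite mul0r.
Qed.

(* Both sides are the sum over all pairs of words (u, v) of R u * S v times  *)
(* the coefficient of m in the image of u v.                                 *)
Lemma fsubstM : {morph fsubst f : R S / R * S}.
Proof.
move=> R S; apply/fpsP => m.
pose T (q : {fmonom nat} * {fmonom nat}) := R q.1 * S q.2 * (P q.1 * P q.2) m.
transitivity (\sum_(q \in [set: {fmonom nat} * {fmonom nat}]) T q).
  pose r : seq {fmonom nat} := fset_set [set w | P w m != 0].
  have rE w : (w \in r) = (P w m != 0).
    by rewrite in_fset_set //; apply/idP/idP; rewrite inE.
  rewrite (@fsubstE _ _ r) ?fset_uniq // => [|w]; last by rewrite rE.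
  transitivity (\sum_(q <- [seq q | w <- r, q <- factors w]) T q).
    rewrite big_allpairs_dep; apply: eq_bigr => w _.
    rewrite fpsME mulr_suml; apply: eq_big_seq => q; rewrite factorsP => /eqP qw.
    by rewrite /T -PM qw.
  apply/esym/fsbigT_seq.
    apply: allpairs_uniq_dep => [|w _|]; rewrite ?fset_uniq ?factors_uniq //.
    move=> _ _ /allpairsPdep[w [q [_ qw ->]]] /allpairsPdep[w' [q' [_ qw' ->]]] /=.
    move: qw qw'; rewrite !factorsP => /eqP <- /eqP <- qq.
    by rewrite [q]qq.
  move=> q; apply: contraNeq; rewrite /T -PM mulf_eq0 negb_or => /andP[_ qm].
  by apply/allpairsPdep; exists (mmul q.1 q.2), q; rewrite rE factorsP qm eqxx.
(* Both words of a contributing pair lie in [supp m], so the sum over pairs can be taken over a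
   finite square. *)
rewrite (@fsbigT_seq _ _ _ _ [seq (u, v) | u <- supp m, v <- supp m]) //; first last.
- move=> [u v]; apply: contraNeq; rewrite /T mulf_eq0 negb_or /= => /andP[_ uv].
  have /hasP[p mp] : has (fun p => P u p.1 * P v p.2 != 0) (factors m).
    apply: contraNT uv => /hasPn F0; rewrite fpsME big_seq big1 // => p.
    by move/F0; rewrite negbK => /eqP.
  rewrite mulf_eq0 negb_or => /andP[up vp].
  by apply: allpairs_f; apply: (suppP _ _ _ mp); [left|right].
- by apply: allpairs_uniq; rewrite ?fset_uniq // => -[? ?] [? ?].
rewrite big_allpairs fpsME /T.
under eq_bigr do under eq_bigr do rewrite /= fpsME mulr_sumr.
under eq_bigr do rewrite exchange_big /=.
rewrite exchange_big /=; apply: eq_big_seq => p mp.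
rewrite !(@fsubstE _ _ (supp m)) ?fset_uniq //; first last.
- by move=> w wp; apply: (suppP _ _ _ mp); left.
- by move=> w wp; apply: (suppP _ _ _ mp); right.
rewrite mulr_suml; apply: eq_bigr => u _; rewrite mulr_sumr.
by apply: eq_bigr => v _; rewrite mulrACA.
Qed.

(** This also covers non-units: the inverse is the identity there, and substitution preserves the
    constant term that decides invertibility. *)
Lemma fsubstV R : fsubst f R^-1 = (fsubst f R)^-1.
Proof.
have [RU|RU] := boolP (R \is a GRing.unit).
  have fRU : fsubst f R \is a GRing.unit.
    by move: RU; rewrite !fps_unitE fsubst1.
  by apply: (mulrI fRU); rewrite -fsubstM !divrr // fsubst_one.
by rewrite !invr_out //; move: RU; rewrite !fps_unitE fsubst1.
Qed.
End SubstitutionMorphism.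

Lemma map_predK (r : seq nat) : all (leq 1) r -> map succn (map predn r) = r.
Proof.
move=> /allP r_ge1; rewrite -map_comp; apply: map_id_in => k /r_ge1.
exact: prednK.
Qed.

(** * The shift and its iterates *)

Section Shift.
Context (K : fieldType).
Implicit Types (R S : ncfps K) (w : {fmonom nat}).

Lemma prod_X r : \prod_(k <- r) X_ K k = mono K (FMonom r).
Proof.
elim: r => [|k r IHr]; first by rewrite big_nil -[FMonom [::]]fmK -fm1 fmK.
by rewrite big_cons IHr monoM; congr mono; apply: val_inj; rewrite /= fmM fmU.
Qed.

Lemma shiftE R w :
  shift R w = if all (leq 1) w then R (FMonom (map predn w)) else 0.
Proof.
rewrite /shift /fsubst /fpsum.
under eq_fsbigr => v _.
  rewrite fpsZE -(big_map succn xpredT (X_ K)) prod_X /mono.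
  over.
have mapSK : cancel (map succn) (map predn) by exact: mapK.
case: ifPn => [w_ge1|w_ge1].
  have wE := map_predK _ w_ge1.
  rewrite (@fsbigT_seq _ _ _ _ [:: FMonom (map predn w)]) //.
    by rewrite big_seq1 /= wE fmK eqxx mulr1.
  move=> v; rewrite inE => vw; have [wv|] := eqVneq w; last by rewrite mulr0.
  by rewrite wv /= mapSK fmK eqxx in vw.
rewrite fsbig1 // => v _; have [wv|] := eqVneq w; last by rewrite mulr0.
by case/negP: w_ge1; rewrite wv all_map; apply/allP.
Qed.

(** The sum is reindexed along the injective relabeling k -> k+1 of words, whose image carries the
    support of [shift R]. *)
Lemma fsubst_shift (M : ffMonomType) (g : nat -> fps K M) R :
  fsubst g (shift R) = fsubst (g \o succn) R.
Proof.
pose h (v : {fmonom nat}) := FMonom (map succn v).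
have h_inj : injective h.
  by move=> u v [] /(inj_map succn_inj) uv; apply: val_inj.
apply/fpsP => m; rewrite /fsubst /fpsum.
rewrite -(@fsbig_widen _ _ _ _ (h @` setT)) //; last first.
  move=> w [_ wh] /=; rewrite fpsZE shiftE; case: ifPn; last by rewrite mul0r.
  move=> w_ge1; case: wh; exists (FMonom (map predn w)) => //; apply: val_inj.
  exact: map_predK.
rewrite fsbig_image; last by move=> u v _ _; exact: h_inj.
apply: eq_fsbigr => v _; rewrite !fpsZE shiftE /h /= big_map mapK // fmK.
by rewrite all_map (_ : all _ _) //; apply/allP.
Qed.

Lemma fsubst_iter_shift (M : ffMonomType) (g : nat -> fps K M) j R :
  fsubst g (iter j (@shift K) R) = fsubst (fun k => g (j + k)%N) R.
Proof. by elim: j g => // j IHj g; rewrite iterS fsubst_shift IHj. Qed.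

Lemma iter_shift1 j R : iter j (@shift K) R mone = R mone.
Proof.
by elim: j => //= j <-; apply: fsubst1 => k; exact: X_1.
Qed.

Lemma iter_shift_neq0 j R w : iter j (@shift K) R w != 0 -> all (leq j) w.
Proof.
elim: j w => [|j IHj] w; first by move=> _; exact/allP.
rewrite iterS shiftE; case: ifPn => [w_ge1 /IHj|_]; last by rewrite eqxx.
rewrite /= all_map => /allP w_gt; apply/allP => k kw.
by rewrite -(prednK (allP w_ge1 _ kw)) ltnS; exact: w_gt.
Qed.

(** All letters of the k-th shift are at least k, so the first letter of w bounds k; the empty word
    is excluded by the zero constant term. This makes plethysm a locally finite substitution. *)
Lemma iter_shift_fin R w : R mone = 0 ->
  finite_set [set k | iter k (@shift K) R w != 0].
Proof.
move=> R1; have [->|w1] := eqVneq w mone.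
  by apply: (sub_finite_set _ (finite_set0 nat)) => k /=; rewrite iter_shift1 R1 eqxx.
apply: (sub_finite_set _ (finite_II (head 0%N w).+1)) => k /iter_shift_neq0 /=.
case: w w1 => -[|l r] /=; first by rewrite -fdeg_eq0.
by move=> _ /andP[].
Qed.

Lemma mono_inj_fin (M : ffMonomType) (h : nat -> M) m : injective h ->
  finite_set [set k | mono K (h k) m != 0].
Proof.
move=> h_inj; apply: finite_set_subsingleton => k l /=; rewrite /mono.
have [->|] := eqVneq m (h k); last by rewrite eqxx.
by have [/h_inj|] := eqVneq (h k) (h l); last by rewrite eqxx.
Qed.

Lemma fmu_inj : injective (@fmu nat).
Proof. by move=> k l /(congr1 (@fmonom_val nat)); rewrite !fmU => -[]. Qed.

Let XS1 k : X_ K k.+1 mone = 0. Proof. exact: X_1. Qed.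
Let XS_fin w : finite_set [set k | X_ K k.+1 w != 0].
Proof. by apply: mono_inj_fin => k l /fmu_inj []. Qed.

Lemma shift_one : shift 1 = 1 :> ncfps K.
Proof. exact: fsubst_one. Qed.
Lemma shiftX k : shift (X_ K k) = X_ K k.+1.
Proof. exact: fsubstX. Qed.
Lemma shiftB : {morph @shift K : R S / R - S}.
Proof. exact: fsubstB. Qed.
Lemma shiftM : {morph @shift K : R S / R * S}.
Proof. exact: fsubstM. Qed.
Lemma shiftV R : shift R^-1 = (shift R)^-1.
Proof. exact: fsubstV. Qed.
End Shift.

(** * Characteristic series of languages *)

Definition word_series (K : fieldType) (L : pred (seq nat)) : ncfps K :=
  fun w => (L w)%:R.

(** Unambiguous concatenation: the unique cut of a word of L is the only factorization with a
    nonzero term. *)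
Lemma word_seriesM (K : fieldType) (L1 L2 L : pred (seq nat)) :
  (forall u v, L1 u -> L2 v -> L (u ++ v)) ->
  (forall w, L w -> exists u v, [/\ w = u ++ v, L1 u & L2 v]) ->
  (forall u v u' v', L1 u -> L2 v -> L1 u' -> L2 v' -> u ++ v = u' ++ v' -> u = u') ->
  word_series K L1 * word_series K L2 = word_series K L.
Proof.
move=> L_cat cat_L L_uniq; apply/fpsP => w; rewrite fpsME /word_series.
have [Lw|Lw] := boolP (L w); last first.
  rewrite big_seq big1 // => p; rewrite factorsP => /eqP pw.
  have [L1p|] := boolP (L1 p.1); last by rewrite mul0r.
  have [L2p|] := boolP (L2 p.2); last by rewrite mulr0.
  by case/negP: Lw; rewrite -pw fmM L_cat.
have [u [v [wE L1u L2v]]] := cat_L _ Lw.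
have uvw : (FMonom u, FMonom v) \in factors w.
  by rewrite factorsP; apply/eqP/val_inj; rewrite /= fmM wE.
rewrite (bigD1_seq _ uvw) ?factors_uniq //= L1u L2v mulr1.
rewrite big_seq_cond big1 ?addr0 // => -[a b] /=; rewrite factorsP /= => /andP[/eqP abw].
have [L1a|] := boolP (L1 a); last by rewrite mul0r.
have [L2b|] := boolP (L2 b); last by rewrite mulr0.
have abE : a ++ b = u ++ v by rewrite -fmM abw wE.
have au : a = u :> seq nat by exact: L_uniq abE.
have bv : b = v :> seq nat by move/eqP: abE; rewrite au eqseq_cat // eqxx => /eqP.
by case/eqP; congr pair; apply: val_inj.
Qed.

(** * Two factorizations of C *)

Section CSeries.
Context (K : fieldType) (n : nat).
Implicit Types (u v w : seq nat).

Let step k l := (l <= k + n)%N.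

Definition C_words j w := all (leq j.+1) w && sorted step w.

(** The language of V. The default 0 of [head] admits the empty word. *)
Definition low_words w := C_words 1 w && (head 0%N w <= n.+1)%N.

Lemma iter_shift_C j :
  iter j (@shift K) (C_series K n) = word_series K (C_words j).
Proof.
elim: j => // j IHj; apply/fpsP => w; rewrite iterS shiftE IHj /word_series.
case: ifPn => [w_ge1|w_ge1].
  rewrite /C_words -{3 4}(map_predK _ w_ge1) all_map sorted_map.
  by congr (_ && _)%:R; exact: eq_sorted.
suff /negbTE w_gt : ~~ all (leq j.+2) w by rewrite /C_words w_gt.
by apply: contra w_ge1; apply: sub_all => k; exact: leq_trans.
Qed.

(** At the junction the last letter of u is at least 1 and the first of v at most n+1, so the
    increase is at most n. *)
Lemma sorted_cat_low u v : all (leq 1) u -> sorted step u -> sorted step v ->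
  (head 0%N v <= n.+1)%N -> sorted step (u ++ v).
Proof.
case: u => //= k u /andP[k1 u1] ku; rewrite cat_path ku /=.
case: v => //= l v -> ln; rewrite andbT /step (leq_trans ln) // -add1n leq_add2r.
by apply: (allP (_ : all (leq 1) (k :: u)));[rewrite /= k1|exact: mem_last].
Qed.

(** As p fails at 0, the default of [head], the cut may also fall at the end of the word. *)
Let split_prefix (p : pred nat) w : ~~ p 0%N ->
  exists u v, [/\ w = u ++ v, all p u & ~~ p (head 0%N v)].
Proof.
move=> p0; elim: w => [|k w [u [v [-> pu pv]]]]; first by exists [::], [::].
have [pk|pk] := boolP (p k); first by exists (k :: u), v; rewrite /= pk.
by exists [::], (k :: u ++ v).
Qed.

Let prefix_uniq (p : pred nat) u v u' v' :
  all p u -> ~~ p (head 0%N v) -> all p u' -> ~~ p (head 0%N v') ->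
  u ++ v = u' ++ v' -> u = u'.
Proof.
elim: u u' => [|k u IHu] [|k' u'] //=.
- by move=> _ /negbTE pv /andP[pk' _] _ vE; rewrite vE /= pk' in pv.
- by move=> /andP[pk _] _ _ /negbTE pv' vE; rewrite -vE /= pk in pv'.
move=> /andP[_ pu] pv /andP[_ pu'] pv' [-> uv]; congr cons.
exact: IHu uv.
Qed.

(* Cut a word before its first letter that is at most n+1. *)
Lemma shift_C_factor :
  shift (C_series K n) =
  iter n.+1 (@shift K) (C_series K n) * word_series K low_words.
Proof.
rewrite -[LHS]/(iter 1 (@shift K) _) !iter_shift_C; apply/esym/word_seriesM.
- move=> u v /andP[u_gt su] /andP[/andP[v_gt sv] v_low].
  rewrite /C_words all_cat v_gt andbT sorted_cat_low ?andbT //.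
    by apply: sub_all u_gt => k; exact: leq_trans.
  by apply: sub_all u_gt => k; exact: leq_trans.
- move=> w /andP[w_gt sw].
  have [u [v [wE u_gt v_low]]] := split_prefix (leq n.+2) w isT.
  move: w_gt sw; rewrite wE all_cat => /andP[_ v_gt] /cat_sorted2[su sv].
  exists u, v; split => //; first by rewrite /C_words u_gt.
  by rewrite /low_words /C_words v_gt sv leqNgt.
- move=> u v u' v' /andP[u_gt _] /andP[_ v_low] /andP[u'_gt _] /andP[_ v'_low].
  by apply: (prefix_uniq (leq n.+2)); rewrite // -ltnNge.
Qed.

Let split_last (x : nat) w : x \in w ->
  exists u v, w = u ++ x :: v /\ x \notin v.
Proof.
elim: w => // k w IHw; have [/IHw[u [v [-> xv]]] _|xw] := boolP (x \in w).
  by exists (k :: u), v.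
by rewrite inE (negbTE xw) orbF => /eqP <-; exists [::], w.
Qed.

Let last_uniq (x : nat) u v u' v' : x \notin v -> x \notin v' ->
  u ++ x :: v = u' ++ x :: v' -> u = u'.
Proof.
elim: u u' => [|k u IHu] [|k' u'] //=.
- by move=> xv _ [_ vE]; rewrite vE mem_cat inE eqxx orbT in xv.
- by move=> _ xv' [_ vE]; rewrite -vE mem_cat inE eqxx orbT in xv'.
by move=> xv xv' [-> uv]; congr cons; exact: IHu uv.
Qed.

Let one_notin_low v : low_words v -> 1%N \notin v.
Proof. by move=> /andP[/andP[v_gt _] _]; apply/negP => /(allP v_gt). Qed.

(* Cut a word of C that is not in shift C at its last letter 1. *)
Lemma C_factor :
  C_series K n =
  shift (C_series K n) + C_series K n * (X_ K 1 * word_series K low_words).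
Proof.
pose one_low w := if w is k :: v then (k == 1%N) && low_words v else false.
have -> : X_ K 1 * word_series K low_words = word_series K one_low.
  have -> : X_ K 1 = word_series K (pred1 [:: 1%N]).
    apply/fpsP => w; rewrite /X_ /mono /word_series /=; congr (nat_of_bool _)%:R.
    by rewrite -val_eqE /= fmU.
  apply: word_seriesM => [u v /eqP -> //|[|k v] // /andP[/eqP -> lv]|].
    by exists [:: 1%N], v.
  by move=> u v u' v' /eqP -> _ /eqP ->.
have -> : C_series K n * word_series K one_low =
    word_series K (fun w => C_words 0 w && (1%N \in w)).
  rewrite -[C_series K n]/(iter 0 (@shift K) _) iter_shift_C; apply: word_seriesM.
  - move=> u [|k v] // /andP[u_gt su] /andP[/eqP-> /andP[/andP[v_gt sv] v_low]].
    rewrite mem_cat inE eqxx orbT andbT /C_words all_cat u_gt /=.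
    rewrite (sub_all _ v_gt) => [|l]; last exact: leq_trans.
    by apply: sorted_cat_low => //; exact: (sorted_cat_low [:: 1%N]).
  - move=> w /andP[/andP[w_gt sw]] /split_last[u [v [wE v1]]].
    move: w_gt sw; rewrite wE all_cat /= => /andP[u_gt v_gt] suv.
    have [su sv] := cat_sorted2 suv.
    exists u, (1%N :: v); split => //; first by rewrite /C_words u_gt.
    rewrite /= /low_words /C_words (path_sorted sv) andbT; apply/andP; split.
      apply/allP => k kv; rewrite ltn_neqAle (allP v_gt) // andbT.
      by apply: contraNneq v1 => ->.
    by move: sv; case: (v) => //= k r /andP[].
  - move=> u [|k v] u' [|k' v'] // _ /andP[/eqP-> lv] _ /andP[/eqP-> lv'].
    by apply: last_uniq; exact: one_notin_low.
rewrite -[C_series K n]/(iter 0 (@shift K) _) -iterS !iter_shift_C.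
apply/fpsP => w; rewrite fpsDE /word_series -natrD; congr _%:R.
(* The words of s C are those of C without the letter 1, so the two summands split C into disjoint
   languages. *)
have -> : C_words 1 w = C_words 0 w && (1%N \notin (w : seq nat)); last first.
  by case: (C_words 0 w); case: (1%N \in _).
rewrite /C_words andbAC; congr (_ && _); rewrite -has_pred1 -all_predC -all_predI.
by apply: eq_all => k /=; rewrite ltn_neqAle eq_sym andbC.
Qed.
End CSeries.

(** * The tree series in closed form *)

Section TreeSeries.
Context (K : fieldType) (n : nat).

Let C := C_series K n.
Let A := X_ K 0 * (iter n (@shift K) C)^-1 * C.

Let A1 : A mone = 0.
Proof. by rewrite /A -mulrA fpsM1 X_1 mul0r. Qed.

Lemma one_sub_shift_tree j :
  1 - iter j.+1 (@shift K) A =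
  (iter j (@shift K) C)^-1 * iter j.+1 (@shift K) C.
Proof.
elim: j => [|j IHj].
  (* After multiplication by C on the left, [shift_C_factor] cancels the inverse in s A and leaves C
     - C X_1 V, which is s C by [C_factor]. *)
  apply: (mulrI (iter_shift_C_unit K n 0)); rewrite mulVKr ?(iter_shift_C_unit K n 0) //=.
  rewrite /A !shiftM shiftX shiftV -iterS -mulrA /C (shift_C_factor K n).
  rewrite mulKr ?iter_shift_C_unit // mulrBr mulr1 {1}C_factor addrK.
  exact: shift_C_factor.
by rewrite [in LHS]iterS -[1 in LHS](shift_one K) -shiftB IHj shiftM shiftV.
Qed.

Lemma Pi_seriesS j :
  Pi_series K j.+1 = (1 - X_ K j.+1)^-1 * Pi_series K j.
Proof. by rewrite /Pi_series big_ord_recl subn0. Qed.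

(** Telescoping: the new leftmost factor (1 - s^(j+1) A)^-1 equals (s^(j+1) C)^-1 (s^j C), whose
    right half cancels the inverse from the previous step. *)
Lemma Pi_os_tree j :
  Pi_series K j \os A = (iter j (@shift K) C)^-1 * C.
Proof.
have f1 k : iter k (@shift K) A mone = 0 by rewrite iter_shift1.
have f_fin m := iter_shift_fin K A m A1.
rewrite /shift_plethysm; elim: j => [|j IHj].
  rewrite /Pi_series big_ord0 fsubst_one mulVr //; exact: (iter_shift_C_unit K n 0).
rewrite Pi_seriesS fsubstM // IHj fsubstV // fsubstB // fsubst_one fsubstX.
rewrite one_sub_shift_tree invrM ?unitrV ?iter_shift_C_unit // invrK -mulrA.
by rewrite mulVKr ?iter_shift_C_unit.
Qed.

Lemma tree_series_Pi : tree_series (Pi_series K n) = A.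
Proof.
apply: (is_tree_series_uniq (tree_seriesP _)); split => //.
by rewrite Pi_os_tree mulrA.
Qed.
End TreeSeries.

(** * Passage to commutative images *)

Theorem corollary16 (K : fieldType) (charK0 : [pchar K] =i pred0)
    (m : nat) (hm : (2 <= m)%N) :
  let A := tree_series (Pi_series K (m - 1)) in
  let C := C_series K (m - 1) in
  let sC := iter (m - 1) (@shift K) C in
  [/\ A = X_ K 0 * sC^-1 * C,
      comm_image A = xz_z K * xz_x K 0 * (comm_image C / comm_image sC)
    & q_series A (zq_z K)
      = zq_z K * (q_series C (zq_z K)
                  / q_series C (zq_z K * zq_q K ^+ (m - 1)))].
Proof.
move=> A C sC; have AE : A = X_ K 0 * sC^-1 * C by exact: tree_series_Pi.
split=> //.
  pose f k := xz_z K * xz_x K k.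
  have f1 k : f k mone = 0.
    by rewrite /f fpsM1 /xz_z /mono eq_sym cm1_eq1 mul0r.
  have f_fin w : finite_set [set k | f k w != 0].
    (* The monomials z x_k are pairwise distinct, told apart by the exponent of x_k. *)
    rewrite /f /xz_z /xz_x; under eq_set do rewrite monoM.
    apply: mono_inj_fin => k l /(congr1 (fun c : {cmonom option nat} => c (Some k))).
    by rewrite !cmM !cmU eqxx; case: (Some l =P Some k) => [[]|].
  rewrite AE /comm_image !(fsubstM _ _ _ f1 f_fin) (fsubstV _ _ _ f1 f_fin) fsubstX.
  by rewrite -mulrA [_^-1 * _]mulrC.
pose f k := zq_z K * zq_q K ^+ k.
have f1 k : f k mone = 0.
  by rewrite /f fpsM1 /zq_z /mono eq_sym cm1_eq1 mul0r.
have f_fin w : finite_set [set k | f k w != 0].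
  (* Coefficients of q^k in degree below k vanish, so only k up to the degree of w contribute. *)
  apply: (sub_finite_set _ (finite_II (ffdeg w).+1)) => k /=.
  apply: contraNT; rewrite -leqNgt => lt_wk; rewrite /f fpsME big_seq big1 // => p.
  move/factors_deg => dw; rewrite (@fpsX_eq0 _ _ _ k) ?mulr0 //.
    by rewrite /zq_q /mono eq_sym cm1_eq1.
  by rewrite (leq_trans _ lt_wk) // ltnS dw leq_addl.
rewrite AE /q_series !(fsubstM _ _ _ f1 f_fin) (fsubstV _ _ _ f1 f_fin) fsubstX.
(* Shifting m - 1 times replaces z q^k by z q^(m-1+k) = (z q^(m-1)) q^k, which is evaluation at z
   q^(m-1). *)
rewrite {1}/f expr0 mulr1 -mulrA [_^-1 * _]mulrC fsubst_iter_shift.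
rewrite (_ : (fun k => f (m - 1 + k)%N) =
  fun k => zq_z K * zq_q K ^+ (m - 1) * zq_q K ^+ k) //.
by apply/funext => k; rewrite /f exprD mulrA.
Qed.
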